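(* Let $0<\beta<\tfrac12$, let $N$ be a ground set with $|N|=n$, and let $\varepsilon\geq \frac{1}{n^{1/2-\beta}}$. For any (possibly randomized) algorithm in the value query model with query-complexity smaller than $2^{\Omega(n^{\beta/2})}$, there exist a cardinality bound $k$ and an $\varepsilon$-approximately submodular function $F:2^N\to\mathbb{R}$ such that, for the problem $\max_{S\subseteq N,\,|S|\leq k} F(S)$, the algorithm achieves an approximation ratio upper-bounded by $\frac{2}{n^{\beta/2}}$ with probability at least $1-\frac{1}{2^{\Omega(n^{\beta/2})}}$.
   Context: A function $f:2^N\to\mathbb{R}$ is submodular if $f(S\cup T)+f(S\cap T)\leq f(S)+f(T)$ for all $S,T\subseteq N$; throughout, submodular functions are normalized ($f(\emptyset)=0$) and monotone ($f(S)\le f(T)$ for $S\subseteq T$). A function $F:2^N\to\mathbb{R}$ is $\varepsilon$-approximately submodular if there exists a (normalized monotone) submodular $f:2^N\to\mathbb{R}$ with $(1-\varepsilon)f(S)\leq F(S)\leq(1+\varepsilon)f(S)$ for all $S\subseteq N$. In the value query model the algorithm accesses $F$ only through an oracle returning $F(S)$ for a queried set $S$; query-complexity is the number of queries. A set $S$ with $|S|\le k$ achieves approximation ratio $\alpha$ if $F(S)\geq \alpha\max_{|T|\le k}F(T)$. *)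

(* Defs.v *)
From mathcomp Require Import all_boot all_order all_algebra.
From mathcomp Require Import all_classical all_reals all_analysis.
Set Implicit Arguments.
Unset Strict Implicit.
Unset Printing Implicit Defensive.
Import Order.TTheory GRing.Theory Num.Theory.
Local Open Scope classical_set_scope.
Local Open Scope ring_scope.

Section Submodular.
Variables (R : realType) (N : finType).
Implicit Types f F : {set N} -> R.

Definition submodular f : Prop :=
  forall S T : {set N}, f (S :|: T)%SET + f (S :&: T)%SET <= f S + f T.

Definition normalized f : Prop := f finset.set0 = 0.

Definition monotone f : Prop :=
  forall S T : {set N}, S \subset T -> f S <= f T.

Definition approx_submodular (eps : R) F : Prop :=
  exists f : {set N} -> R,
    [/\ normalized f, monotone f, submodular f &
      forall S : {set N}, (1 - eps) * f S <= F S <= (1 + eps) * f S].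

(* The empty set is always feasible, so F set0 is a harmless base value. *)
Definition max_card F (k : nat) : R :=
  \big[Num.max/F finset.set0]_(T : {set N} | (#|T| <= k)%N) F T.

Definition achieves_ratio F (k : nat) (S : {set N}) (alpha : R) : Prop :=
  (#|S| <= k)%N /\ alpha * max_card F k <= F S.

(* Quantifying over achieved ratios, rather than writing
   F S <= r * max_card F k, keeps this false for feasible S in the degenerate
   case max_card F k = 0, where every ratio is achieved. An infeasible S
   achieves no ratio at all. *)
Definition ratio_at_most F (k : nat) (S : {set N}) (r : R) : Prop :=
  forall alpha : R, achieves_ratio F k S alpha -> alpha <= r.

End Submodular.

(* A deterministic adaptive algorithm in the value query model: it sees the
   objective only through the answers passed to the continuation of Query. *)
Inductive query_alg (R : realType) (N : finType) : Type :=
| Output of {set N}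
| Query of {set N} & (R -> query_alg R N).

Fixpoint output (R : realType) (N : finType) (F : {set N} -> R)
    (A : query_alg R N) : {set N} :=
  match A with
  | Output B => B
  | Query Q next => output F (next (F Q))
  end.

Fixpoint num_queries (R : realType) (N : finType) (F : {set N} -> R)
    (A : query_alg R N) : nat :=
  match A with
  | Output _ => 0
  | Query Q next => (num_queries F (next (F Q))).+1
  end.

(* A randomized algorithm receives the cardinality bound k and a random seed w
   in T, and then runs a deterministic algorithm; its output on every instance
   is required to be a random variable. *)
Record rand_query_alg (R : realType) (N : finType) (d : measure_display)
    (T : measurableType d) : Type := RandQueryAlg {
  alg_of :> nat -> T -> query_alg R N;
  measurable_output : forall (k : nat) (F : {set N} -> R) (S : {set N}),
    measurable [set w | output F (alg_of k w) = S] }.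

(* Worst case over the bound k, the eps-approximately submodular instance F and
   the seed w. *)
Definition query_complexity_lt (R : realType) (N : finType)
    (d : measure_display) (T : measurableType d) (eps : R)
    (A : rand_query_alg R N T) (q : R) : Prop :=
  forall (k : nat) (F : {set N} -> R) (w : T),
    approx_submodular eps F -> (num_queries F (A k w))%:R < q.

(* Main.v *)
Require Import Defs.
From mathcomp Require Import all_boot all_order all_algebra.
From mathcomp Require Import all_classical all_reals all_analysis.
From mathcomp Require Import measurable_realfun ring lra.
(**
Hide a random multiset h of k ~ n^(1 - beta/2) independent uniform elements of N
inside the rank-one-plus-modular function f_h(S) = M [S <> 0] + #{i | h_i in S},
with M = n^(1 - beta) / 2, and compare it with its average over h,
u(S) = M [S <> 0] + k |S| / n. The instance F_h equals u wherever
|f_h - u| <= sqrt n / 2 <= eps M, and f_h elsewhere, so it is always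
eps-approximately submodular. By Hoeffding, for each fixed S, F_h(S) <> u(S)
with probability at most 2 exp (- n^(beta/2) / 32) over h. For a fixed seed,
unless this happens for one of the few sets queried in the run on u (or for its
output), the runs on F_h and on u coincide; the output S, if feasible, then has
value u(S) <= M + k^2 / n <= 2 k / n^(beta/2), whereas the image of h is feasible
and has value at least k. Averaging over the seed and h yields one h that
works; no measurability of the queries is needed, only that of the output.
*)

Set Implicit Arguments.
Unset Strict Implicit.
Unset Printing Implicit Defensive.
Import Order.TTheory GRing.Theory Num.Theory.
Local Open Scope classical_set_scope.
Local Open Scope ring_scope.

(** * Exponential moments and a Hoeffding-type tail bound *)

Section Tail.
Variable R : realType.

(** After multiplication by [1 - x > 0], the left side is at most 1 because [1 - x <= expR (- x)],
    and the right side is [1 + x ^+ 2 * (1 - 2 * x) >= 1]. *)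
Lemma expR_le_quadratic (x : R) : x <= 1 / 2 -> expR x <= 1 + x + 2 * x ^+ 2.
Proof.
move=> x2; have x1 : 0 < 1 - x by lra.
have le1 : expR x * (1 - x) <= 1.
  rewrite -[leRHS](expRxMexpNx_1 x) ler_wpM2l ?expR_ge0 //.
  by rewrite expR_ge1Dx.
rewrite -(ler_pM2r x1) (le_trans le1) //.
have -> : (1 + x + 2 * x ^+ 2) * (1 - x) = 1 + x ^+ 2 * (1 - 2 * x) by ring.
by rewrite lerDl mulr_ge0 ?sqr_ge0 //; lra.
Qed.

Variables (N : finType) (k : nat).

(** The linear term of the quadratic bound sums to 0 since [g] is centred; then [1 + y <= expR y] is
    applied to [y = 2 * l ^+ 2]. *)
Lemma mgf_le (g : N -> R) (l : R) : \sum_x g x = 0 ->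
    (forall x, `|g x| <= 1) -> 0 <= l <= 1 / 2 ->
  \sum_x expR (l * g x) <= #|N|%:R * expR (2 * l ^+ 2).
Proof.
move=> g0 g1 /andP[l0 l2].
apply: (@le_trans _ _ (\sum_x (1 + l * g x + 2 * l ^+ 2))).
  apply: ler_sum => x _; have := g1 x; rewrite ler_norml => /andP[ga gb].
  apply: (le_trans (expR_le_quadratic _)); first by nra.
  by rewrite lerD2l ler_pM2l // exprMn ler_piMr ?sqr_ge0 //; nra.
rewrite !big_split /= -mulr_sumr g0 mulr0 addr0 -big_split /= sumr_const.
by rewrite -[_ *+ _]mulr_natl ler_wpM2l ?expR_ge1Dx.
Qed.

Lemma hoeffding_upper (g : N -> R) (tau : R) : \sum_x g x = 0 ->
    (forall x, `|g x| <= 1) -> 0 <= tau <= 2 * k%:R -> (0 < k)%N ->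
  #|[pred h : {ffun 'I_k -> N} | tau < \sum_i g (h i)]|%:R
    <= expR (- (tau ^+ 2 / (8 * k%:R))) * #|{ffun 'I_k -> N}|%:R.
Proof.
move=> g0 g1 /andP[t0 t2] k0; have kR : (0 : R) < k%:R by rewrite ltr0n.
(* The minimiser of the Chernoff exponent [2 * k * l ^+ 2 - l * tau]; the upper bound on [tau] gives
   [l <= 1 / 2]. *)
pose l := tau / (4 * k%:R).
have lP : 0 <= l <= 1 / 2.
  have k4 : 0 < 4 * k%:R :> R by rewrite mulr_gt0.
  by rewrite /l divr_ge0 ?(ltW k4) //= ler_pdivrMr //; lra.
apply: (@le_trans _ _
  (\sum_(h : {ffun 'I_k -> N}) expR (l * ((\sum_i g (h i)) - tau)))).
  rewrite -sum1_card natr_sum big_mkcond /=; apply: ler_sum => h _.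
  case: ifP => [ht|_]; last exact: expR_ge0.
  rewrite -[leLHS]expR0 ler_expR mulr_ge0 ?subr_ge0 ?(ltW ht) //.
  by case/andP: lP.
under eq_bigr => h _.
  rewrite mulrBr expRB mulrC mulr_sumr expR_sum; over.
(* Independence of the coordinates of [h]: the sum over all functions factorises coordinatewise. *)
rewrite -mulr_sumr -(bigA_distr_bigA (fun _ x => expR (l * g x))) /=.
rewrite prodr_const card_ord card_ffun card_ord.
apply: (@le_trans _ _ ((expR (l * tau))^-1 * (#|N|%:R * expR (2 * l ^+ 2)) ^+ k)).
  rewrite ler_wpM2l ?invr_ge0 ?expR_ge0 // lerXn2r ?nnegrE ?mulr_ge0 ?expR_ge0 //.
    by rewrite sumr_ge0 // => x _; exact: expR_ge0.
  exact: mgf_le.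
rewrite exprMn -expRM_natl natrX mulrCA -expRN -expRD mulrC.
rewrite ler_wpM2r ?exprn_ge0 // ler_expR le_eqVlt; apply/orP; left; apply/eqP.
by rewrite /l; field; rewrite gt_eqF.
Qed.

Lemma hoeffding (g : N -> R) (tau : R) : \sum_x g x = 0 ->
    (forall x, `|g x| <= 1) -> 0 <= tau <= 2 * k%:R -> (0 < k)%N ->
  #|[pred h : {ffun 'I_k -> N} | tau < `|\sum_i g (h i)|]|%:R
    <= 2 * expR (- (tau ^+ 2 / (8 * k%:R))) * #|{ffun 'I_k -> N}|%:R.
Proof.
move=> g0 g1 t k0.
have Ng0 : \sum_x - g x = 0 by rewrite sumrN g0 oppr0.
have Ng1 x : `|- g x| <= 1 by rewrite normrN.
apply: le_trans (_ : _ <= #|[pred h : {ffun 'I_k -> N} | tau < \sum_i g (h i)]|%:R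
  + #|[pred h : {ffun 'I_k -> N} | tau < \sum_i - g (h i)]|%:R) _; last first.
  have := hoeffding_upper Ng0 Ng1 t k0; have := hoeffding_upper g0 g1 t k0.
  by move=> up lo; rewrite -mulrA [leRHS]mulr_natl mulr2n lerD.
rewrite -natrD ler_nat -cardUI.
apply: leq_trans (leq_addr _ _); apply: subset_leq_card; apply/fintype.subsetP => h.
by rewrite !inE ltr_normr sumrN.
Qed.

End Tail.

(** * The uniform, planted and masked objectives *)

Section Instance.
Variables (R : realType) (N : finType).

Definition base_plus_weights (M : R) (c : N -> R) (S : {set N}) : R :=
  M *+ (S != finset.set0) + \sum_(x in S) c x.

Section Submod.
Variables (M : R) (c : N -> R).
Hypotheses (M_ge0 : 0 <= M) (c_ge0 : forall x, 0 <= c x).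
Let f := base_plus_weights M c.

Lemma base_plus_weights0 : normalized f.
Proof. by rewrite /normalized /f /base_plus_weights eqxx big_set0 addr0. Qed.

Lemma base_plus_weights_mono : Defs.monotone f.
Proof.
move=> S T ST; rewrite /f /base_plus_weights lerD //.
  apply: ler_wpMn2l => //; case: eqVneq => //= S0; case: eqVneq => // T0.
  by move: ST S0; rewrite T0 finset.subset0 => ->.
rewrite big_mkcond [leRHS]big_mkcond /=; apply: ler_sum => x _.
by case: ifP => [/(fintype.subsetP ST) -> //|_]; case: ifP.
Qed.

(** The weights give equality. For the base term, both sides agree if [S] or [T] is empty; otherwise
    the right side is [2 * M]. *)
Lemma base_plus_weights_submod : submodular f.
Proof.
move=> S T; rewrite /f /base_plus_weights addrACA [leRHS]addrACA lerD //.
  rewrite -!mulrnDr; apply: ler_wpMn2l => //.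
  have [->|S0] := eqVneq S finset.set0.
    by rewrite finset.set0U finset.set0I eqxx /= addn0.
  have [->|T0] := eqVneq T finset.set0.
    by rewrite finset.setU0 finset.setI0 eqxx S0.
  by rewrite leq_add ?leq_b1.
rewrite !(big_mkcond (fun x => x \in _)) /= -!big_split /=.
by apply: ler_sum => x _; rewrite !inE; case: (x \in S); case: (x \in T);
  rewrite /= ?addr0 ?add0r.
Qed.

End Submod.

(** The base [M] converts additive into relative error: the submodular function is at least [M] on
    nonempty sets, so [tau] is at most [eps] times its value. *)
Lemma approx_submodular_near (M : R) (c : N -> R) (eps tau : R) (F : {set N} -> R) :
    0 <= eps -> 0 <= M -> (forall x, 0 <= c x) -> tau <= eps * M ->
    F finset.set0 = 0 ->
    (forall S, `|F S - base_plus_weights M c S| <= tau) ->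
  approx_submodular eps F.
Proof.
move=> e0 M0 c0 tM F0 Fc; exists (base_plus_weights M c).
split; [exact: base_plus_weights0|exact: base_plus_weights_mono
  |exact: base_plus_weights_submod|move=> S].
have [->|S0] := eqVneq S finset.set0; first by rewrite F0 base_plus_weights0 !mulr0 lexx.
suff : tau <= eps * base_plus_weights M c S.
  by have := Fc S; rewrite ler_norml => /andP[? ?] ?; apply/andP; split; lra.
apply: (le_trans tM); rewrite ler_wpM2l // /base_plus_weights S0 lerDl.
by rewrite sumr_ge0.
Qed.

Definition uniform_obj (M : R) (k : nat) : {set N} -> R :=
  base_plus_weights M (fun=> k%:R / #|N|%:R).

(* The points h i are counted with multiplicity, so they are genuinely independent
   and their image still has at most k elements. *)
Definition planted_obj (M : R) (k : nat) (h : {ffun 'I_k -> N}) : {set N} -> R :=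
  base_plus_weights M (fun x => \sum_i (h i == x)%:R).

(** Rounding to exactly the average makes the answer on [S] identical for all [h] that are close on
    [S]. *)
Definition masked_obj (M tau : R) (k : nat) (h : {ffun 'I_k -> N}) (S : {set N}) : R :=
  if `|planted_obj M h S - uniform_obj M k S| <= tau then uniform_obj M k S
  else planted_obj M h S.

Section Masked.
Variables (M tau : R) (k : nat).
Hypotheses (M_ge0 : 0 <= M) (tau_ge0 : 0 <= tau).
Implicit Types h : {ffun 'I_k -> N}.

Lemma uniform_objE S :
  uniform_obj M k S = M *+ (S != finset.set0) + k%:R * (#|S|%:R / #|N|%:R).
Proof.
by rewrite /uniform_obj /base_plus_weights sumr_const -[X in _ + X]mulr_natl mulrCA.
Qed.

Lemma planted_objE h S :
  planted_obj M h S = M *+ (S != finset.set0) + \sum_i (h i \in S)%:R.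
Proof.
rewrite /planted_obj /base_plus_weights exchange_big /=; congr (_ + _).
apply: eq_bigr => i _; rewrite big_mkcond (bigD1 (h i)) //= eqxx big1 ?addr0.
  by case: ifP.
by move=> x /negbTE hx; rewrite eq_sym hx; case: ifP.
Qed.

(** The base terms cancel, which leaves [k] independent centred terms, as [hoeffding] requires. *)
Lemma planted_sub_uniform h S :
  planted_obj M h S - uniform_obj M k S =
    \sum_i ((h i \in S)%:R - #|S|%:R / #|N|%:R).
Proof.
rewrite planted_objE uniform_objE sumrB sumr_const card_ord.
by rewrite opprD addrACA subrr add0r -[X in _ = _ - X]mulr_natl.
Qed.

Lemma uniform_obj_approx (eps : R) :
  0 <= eps -> approx_submodular eps (uniform_obj M k).
Proof.
move=> e0; apply: (@approx_submodular_near M (fun=> k%:R / #|N|%:R) _ 0) => //.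
- exact: mulr_ge0.
- exact: base_plus_weights0.
- by move=> S; rewrite subrr normr0.
Qed.

Lemma masked_obj_approx (eps : R) h :
  0 <= eps -> tau <= eps * M -> approx_submodular eps (masked_obj M tau h).
Proof.
move=> e0 tM.
apply: (@approx_submodular_near M (fun x => \sum_i (h i == x)%:R) _ tau) => //.
- by move=> x; exact: sumr_ge0.
- by rewrite /masked_obj /uniform_obj /planted_obj !base_plus_weights0 if_same.
- move=> S; rewrite /masked_obj; case: ifP => [|_].
    by rewrite distrC.
  by rewrite subrr normr0.
Qed.

Hypotheses (k_gt0 : (0 < k)%N) (N_gt0 : (0 < #|N|)%N).

Lemma masked_obj_tail S : tau <= 2 * k%:R ->
  #|[pred h : {ffun 'I_k -> N} | masked_obj M tau h S != uniform_obj M k S]|%:R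
    <= 2 * expR (- (tau ^+ 2 / (8 * k%:R))) * #|{ffun 'I_k -> N}|%:R.
Proof.
move=> t2; have NR : 0 < #|N|%:R :> R by rewrite ltr0n.
pose g (x : N) : R := (x \in S)%:R - #|S|%:R / #|N|%:R.
have p0 : 0 <= #|S|%:R / #|N|%:R :> R by rewrite divr_ge0.
have p1 : #|S|%:R / #|N|%:R <= 1 :> R by rewrite ler_pdivrMr // mul1r ler_nat max_card.
have g0 : \sum_x g x = 0.
  rewrite sumrB sumr_const -[X in _ - X]mulr_natr divfK ?gt_eqF //.
  by rewrite -natr_sum -big_mkcond sum1_card subrr.
have g1 x : `|g x| <= 1.
  by rewrite ler_norml /g; case: (x \in S) => /=; lra.
apply: le_trans (hoeffding g0 g1 _ k_gt0); last by rewrite tau_ge0.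
rewrite ler_nat; apply: subset_leq_card; apply/fintype.subsetP => h.
by rewrite !inE /masked_obj planted_sub_uniform -/g; case: leP => //; rewrite eqxx.
Qed.

Lemma max_card_masked h : tau <= M -> k%:R <= Defs.max_card (masked_obj M tau h) k.
Proof.
move=> tM; pose T : {set N} := [set h i | i : 'I_k]%SET.
have hT i : h i \in T by apply: imset_f.
have T0 : T != finset.set0.
  by apply/set0Pn; exists (h (Ordinal k_gt0)).
have Tk : (#|T| <= k)%N by rewrite (leq_trans (leq_imset_card _ _)) // card_ord.
apply: (@le_trans _ _ (masked_obj M tau h T)); last exact: le_bigmax_cond.
have plantedT : planted_obj M h T = M + k%:R.
  rewrite planted_objE T0; congr (_ + _).
  by under eq_bigr do rewrite hT; rewrite sumr_const card_ord.
rewrite /masked_obj plantedT; case: ifP => [|_]; last by rewrite lerDr.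
(* If [T] is masked, its value is still at least [M + k - tau >= k]. *)
by rewrite ler_norml => /andP[_]; lra.
Qed.

Lemma masked_ratio h S (r : R) : tau <= M ->
    M + k%:R ^+ 2 / #|N|%:R <= r * k%:R -> 0 <= r ->
    masked_obj M tau h S = uniform_obj M k S ->
  ratio_at_most (masked_obj M tau h) k S r.
Proof.
move=> tM rk r0 hS alpha [Sk]; rewrite hS => le_aS.
have [//|ra] := leP alpha r.
have kR : 0 < k%:R :> R by rewrite ltr0n.
have NR : 0 < #|N|%:R :> R by rewrite ltr0n.
have le_U : uniform_obj M k S <= M + k%:R ^+ 2 / #|N|%:R.
  rewrite uniform_objE lerD //; first by case: eqP.
  by rewrite expr2 -mulrA ler_pM2l // ler_pM2r ?invr_gt0 // ler_nat.
(* A ratio above [r] would force the value of [S] above [r * k], contradicting [le_U] and [rk]. *)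
suff : r * k%:R < alpha * Defs.max_card (masked_obj M tau h) k by lra.
apply: (@lt_le_trans _ _ (alpha * k%:R)); first by rewrite ltr_pM2r.
by rewrite ler_wpM2l ?max_card_masked //; lra.
Qed.

End Masked.
End Instance.

(** * Runs that cannot distinguish the instances *)

Section Queries.
Variables (R : realType) (N : finType).

Fixpoint queries (F : {set N} -> R) (A : query_alg R N) : seq {set N} :=
  match A with
  | Output _ => [::]
  | Query Q next => Q :: queries F (next (F Q))
  end.

Lemma size_queries F A : size (queries F A) = num_queries F A.
Proof. by elim: A => //= Q next IH; rewrite IH. Qed.

(** Each query depends only on earlier answers, so by induction both runs follow the same path,
    however adaptive [A] is. *)
Lemma eq_output F G A : {in queries F A, G =1 F} -> output G A = output F A.
Proof.
elim: A => //= Q next IH GF.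
rewrite GF ?mem_head //; apply: IH => S SF; apply: GF.
by rewrite in_cons SF orbT.
Qed.

Variables (M tau : R) (k : nat) (r : R).
Hypotheses (tau_ge0 : 0 <= tau) (tau_le : tau <= M).
Hypotheses (k_gt0 : (0 < k)%N) (N_gt0 : (0 < #|N|)%N).
Hypotheses (r_ge0 : 0 <= r) (tau_k : tau <= 2 * k%:R).
Hypothesis r_k : M + k%:R ^+ 2 / #|N|%:R <= r * k%:R.

(** A union bound over the sets queried on [uniform_obj], a list that does not depend on [h]. The
    extra one counts the output, whose value must be masked too. *)
Lemma card_bad_instances (A : query_alg R N) :
  #|[pred h : {ffun 'I_k -> N} |
      `[< ~ ratio_at_most (masked_obj M tau h) k (output (masked_obj M tau h) A) r >]]|%:R
  <= (num_queries (uniform_obj M k) A).+1%:R *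
     (2 * expR (- (tau ^+ 2 / (8 * k%:R))) * #|{ffun 'I_k -> N}|%:R).
Proof.
set U := uniform_obj M k; set D := output U A.
pose bad S (h : {ffun 'I_k -> N}) := masked_obj M tau h S != U S.
have M0 : 0 <= M by exact: le_trans tau_le.
apply: (@le_trans _ _ (\sum_(S <- D :: queries U A)
    #|[pred h : {ffun 'I_k -> N} | bad S h]|%:R)).
  rewrite -natr_sum ler_nat.
  under [X in (_ <= X)%N]eq_bigr do rewrite -sum1_card big_mkcond.
  rewrite exchange_big -sum1_card big_mkcond /=; apply: leq_sum => h _.
  case: ifP => // /asboolP nratio.
  have /hasP[S SA bS] : has (bad^~ h) (D :: queries U A).
    apply: contra_notT nratio; rewrite -all_predC => /allP good.
    have goodE S : S \in D :: queries U A -> masked_obj M tau h S = U S.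
      by move=> /good /=; rewrite negbK => /eqP.
    rewrite (@eq_output U) => [|S SA]; last by apply: goodE; rewrite in_cons SA orbT.
    by apply: masked_ratio => //; apply: goodE; rewrite mem_head.
  by rewrite (big_rem S) //= inE bS.
rewrite -size_queries -[(size _).+1]/(size (D :: queries U A)).
rewrite mulr_natl -(count_predT (D :: _)) -iter_addr_0 -big_const_seq.
by apply: ler_sum => S _; apply: masked_obj_tail.
Qed.

End Queries.

(** * Averaging over the seed *)

(** If every [P (B i)] exceeded [c], their sum would exceed [c * #|I|]; but that sum is the integral
    of the number of bad [i], which is bounded pointwise. *)
Lemma exists_le_average (R : realType) (d : measure_display) (T : measurableType d)
    (P : probability T R) (I : finType) (B : I -> set T) (c : R) :
    (forall i, measurable (B i)) -> (0 < #|I|)%N ->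
    (forall w, #|[pred i | `[< B i w >]]|%:R <= c * #|I|%:R) ->
  exists i, (P (B i) <= c%:E)%E.
Proof.
move=> mB I0 cB; apply/not_existsP => ltP.
have : ((c * #|I|%:R)%:E < \sum_(i : I) P (B i))%E.
  have -> : ((c * #|I|%:R)%:E = \sum_(i : I) c%:E)%E.
    by rewrite sumEFin sumr_const mulr_natr.
  have PBfin i : P (B i) = (fine (P (B i)))%:E by rewrite fineK ?fin_num_measure.
  under [X in (_ < X)%E]eq_bigr do rewrite PBfin.
  rewrite !sumEFin lte_fin; case/card_gt0P: I0 => i0 _.
  apply: ltr_sum => [|i _]; first by apply/hasP; exists i0; rewrite ?mem_index_enum.
  by rewrite -lte_fin -PBfin ltNge; apply/negP/ltP.
apply/negP; rewrite -leNgt.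
have -> : (\sum_(i : I) P (B i) = \int[P]_w (\sum_(i : I) (\1_(B i) w)%:E))%E.
  rewrite ge0_integral_sum //.
  - by apply: eq_bigr => i _; rewrite integral_indic // setIT.
  - by move=> i; apply/measurable_EFinP; exact: measurable_indic.
have -> : ((c * #|I|%:R)%:E = \int[P]_(w in setT) cst (c * #|I|%:R)%:E w)%E.
  by rewrite integral_cst //= [X in (_ * X)%E]probability_setT mule1.
apply: ge0_le_integral => //.
- by move=> w _; apply: sume_ge0 => i _; rewrite lee_fin.
- by apply: emeasurable_sum => i; apply/measurable_EFinP; exact: measurable_indic.
move=> w _; rewrite sumEFin lee_fin (le_trans _ (cB w)) //.
rewrite -sum1_card natr_sum [leRHS]big_mkcond /=; apply: ler_sum => i _.
by rewrite indicE inE -[w \in B i]/(`[< B i w >]); case: asbool.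
Qed.

Lemma measurable_output_in (R : realType) (N : finType) (d : measure_display)
    (T : measurableType d) (A : rand_query_alg R N T) (k : nat)
    (F : {set N} -> R) (Q : set {set N}) :
  measurable [set w | Q (output F (A k w))].
Proof.
rewrite [X in measurable X](_ : _ =
    \bigcup_(S in Q) [set w | output F (A k w) = S]).
  by apply: fin_bigcup_measurable => // S _; exact: measurable_output.
by apply/seteqP; split=> w /= => [Qw|[S QS ->//]]; exists (output F (A k w)).
Qed.

(** * Choice of the parameters *)

Section Sizes.
Variables (R : realType) (beta : R) (n : nat).
Hypothesis beta_lt : beta < 1 / 2.
Hypothesis n_ge1 : (0 < n)%N.
(** Most estimates below reduce to [K * x = n], [2 * M * x = K] and [4 * tau ^+ 2 = n]. *)
Let x : R := n%:R `^ (beta / 2).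
Let M : R := n%:R `^ (1 - beta) / 2.
Let tau : R := n%:R `^ (1 / 2) / 2.
Let K : R := n%:R `^ (1 - beta / 2).
Let k : nat := Num.truncn K.

Let n1 : 1 <= n%:R :> R. Proof. by rewrite ler1n. Qed.

Let powD (r s t : R) : r + s = t -> n%:R `^ r * n%:R `^ s = n%:R `^ t :> R.
Proof. by move=> <-; rewrite powRD // pnatr_eq0 -lt0n n_ge1 implybT. Qed.

Let x_gt0 : 0 < x. Proof. by apply: powR_gt0; rewrite ltr0n. Qed.

Let Kx : K * x = n%:R.
Proof. by rewrite (@powD _ _ 1) ?powRr1 //; field. Qed.

Let Mx : 2 * M * x = K.
Proof. by rewrite /M mulrCA divff // mulr1 (@powD _ _ (1 - beta / 2)) //; field. Qed.

Let tau2 : 4 * tau ^+ 2 = n%:R.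
Proof.
rewrite /tau expr_div_n expr2 (@powD _ _ 1) ?powRr1 //; first by field.
by field.
Qed.

Let K_ge1 : 1 <= K.
Proof. by rewrite -(powRr0 n%:R) ler_powR //; move: beta_lt; lra. Qed.

Let k_le : k%:R <= K. Proof. by rewrite truncn_le (le_trans ler01). Qed.

Lemma hidden_size_gt0 : (0 < k)%N. Proof. by rewrite truncn_gt0. Qed.

(** Truncation loses at most a factor 2: [K < k + 1 <= 2 * k]. *)
Let K_le : K <= 2 * k%:R.
Proof.
have /andP[_] := truncn_itv (le_trans ler01 K_ge1); rewrite -natr1.
have : 1 <= k%:R :> R by rewrite ler1n hidden_size_gt0.
rewrite -/k; lra.
Qed.

(** The threshold on [eps] is exactly [tau / M]. *)
Lemma tau_eps (eps : R) : 1 / n%:R `^ (1 / 2 - beta) <= eps -> tau <= eps * M.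
Proof.
rewrite ler_pdivrMr ?powR_gt0 ?ltr0n // => epsE.
have ME : M = tau * n%:R `^ (1 / 2 - beta).
  by rewrite /tau mulrAC (@powD _ _ (1 - beta)) //; field.
by rewrite ME mulrCA ler_peMr // divr_ge0 ?powR_ge0.
Qed.

Lemma tau_le_base : tau <= M.
Proof. by rewrite ler_pM2r ?invr_gt0 // ler_powR //; move: beta_lt; lra. Qed.

Lemma tau_le_size : tau <= 2 * k%:R.
Proof.
apply: le_trans K_le; apply: (@le_trans _ _ (n%:R `^ (1 / 2))).
  by rewrite ler_pdivrMr // ler_peMr ?powR_ge0 // ler1n.
by rewrite ler_powR //; move: beta_lt; lra.
Qed.

(** Each summand is at most [k / x]: [M * x = K / 2 <= k], and [k ^+ 2 / (K * x) <= k / x]. *)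
Lemma value_le_ratio : M + k%:R ^+ 2 / n%:R <= 2 / x * k%:R.
Proof.
have k0 : 0 < k%:R :> R by rewrite ltr0n hidden_size_gt0.
have -> : 2 / x * k%:R = k%:R / x + k%:R / x by ring.
apply: lerD.
  by rewrite ler_pdivlMr //; have := Mx; have := K_le; lra.
rewrite -Kx ler_pdivrMr; last by rewrite mulr_gt0 // (lt_le_trans ltr01).
have -> : k%:R / x * (K * x) = k%:R * K by field; rewrite gt_eqF.
by rewrite expr2 ler_pM2l.
Qed.

Lemma tail_exponent : x / 32 <= tau ^+ 2 / (8 * k%:R).
Proof.
have k0 : 0 < k%:R :> R by rewrite ltr0n hidden_size_gt0.
rewrite ler_pdivlMr ?mulr_gt0 //.
have : k%:R * x <= 4 * tau ^+ 2 by rewrite tau2 -Kx ler_pM2r.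
lra.
Qed.

End Sizes.

(** * Final probability estimate and assembly *)

Lemma union_bound_le (R : realType) (x t : R) (m : nat) :
    128 <= x -> x / 32 <= t -> m%:R < 2 `^ (1 / 128 * x) ->
  m.+1%:R * (2 * expR (- t)) <= 1 / 2 `^ (1 / 128 * x).
Proof.
move=> x128 tx; set z := 2 `^ _ => mz.
have z2 : 2 <= z.
  by rewrite -[leLHS]powRr1 // ler_powR ?ler1n //; lra.
have ez : expR (- t) <= (z ^+ 4)^-1.
  rewrite expRN lef_pV2 ?posrE ?expR_gt0 ?exprn_gt0 ?(lt_le_trans _ z2) //.
  rewrite -powR_mulrn ?(le_trans _ z2) // -powRrM.
  have -> : 1 / 128 * x * 4%:R = x / 32 by field.
  apply: (@le_trans _ _ (expR 1 `^ (x / 32))).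
    rewrite ge0_ler_powR ?nnegrE ?expR_ge0 //; first by lra.
    exact: expR_ge1Dx.
  by rewrite -expRM mul1r ler_expR.
have m2 : m.+1%:R <= 2 * z by rewrite -natr1; lra.
apply: (@le_trans _ _ (2 * z * (2 * (z ^+ 4)^-1))).
  by apply: ler_pM => //; rewrite ?mulr_ge0 ?expR_ge0 // ler_pM2l.
rewrite ler_pdivlMr; last by lra.
have -> : 2 * z * (2 * (z ^+ 4)^-1) * z = 4 / z ^+ 2.
  by field; rewrite gt_eqF //; lra.
by rewrite ler_pdivrMr ?exprn_gt0 //; nra.
Qed.

Theorem theorem1 (R : realType) (beta : R)
    (beta_gt0 : 0 < beta) (beta_lt : beta < 1 / 2) :
  exists (c1 c2 : R) (n0 : nat), 0 < c1 /\ 0 < c2 /\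
  forall (n : nat) (N : finType) (eps : R),
    (n0 <= n)%N -> #|N| = n ->
    1 / (n%:R `^ (1 / 2 - beta)) <= eps ->
  forall (d : measure_display) (T : measurableType d) (P : probability T R)
    (A : rand_query_alg R N T),
    query_complexity_lt eps A (2 `^ (c1 * n%:R `^ (beta / 2))) ->
  exists (k : nat) (F : {set N} -> R),
    approx_submodular eps F /\
    ((1 - 1 / 2 `^ (c2 * n%:R `^ (beta / 2)))%:E <=
      P [set w | ratio_at_most F k (output F (A k w))
                   (2 / n%:R `^ (beta / 2))])%E.
Proof.
pose n0 := (Num.truncn (128 `^ (2 / beta) : R)).+1.
exists (1 / 128), (1 / 128), n0; do 2!split=> //.
move=> n N eps n0n cardN epsE d T P A qA.
have n1 : (0 < n)%N by exact: leq_trans n0n.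
set x := n%:R `^ (beta / 2) in qA *.
have x128 : 128 <= x.
  have -> : 128 = (128 `^ (2 / beta)) `^ (beta / 2) :> R.
    by rewrite -powRrM mulf_div (mulrC beta) divff ?powRr1 // ?mulf_neq0 ?gt_eqF.
  rewrite ge0_ler_powR ?nnegrE ?powR_ge0 ?divr_ge0 ?(ltW beta_gt0) //.
  have /andP[_ /ltW/le_trans] := truncn_itv (powR_ge0 (128 : R) (2 / beta)).
  by apply; rewrite ler_nat.
pose M : R := n%:R `^ (1 - beta) / 2.
pose tau : R := n%:R `^ (1 / 2) / 2.
pose k := Num.truncn (n%:R `^ (1 - beta / 2) : R).
pose r := 2 / x.
have N1 : (0 < #|N|)%N by rewrite cardN.
have tau0 : 0 <= tau by rewrite divr_ge0 ?powR_ge0.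
have M0 : 0 <= M by rewrite divr_ge0 ?powR_ge0.
have r0 : 0 <= r by rewrite divr_ge0 ?powR_ge0.
have eps0 : 0 <= eps by apply: le_trans epsE; rewrite divr_ge0 ?powR_ge0.
have k0 : (0 < k)%N by exact: hidden_size_gt0.
have r_k : M + k%:R ^+ 2 / #|N|%:R <= r * k%:R.
  by rewrite cardN; exact: value_le_ratio.
pose F (h : {ffun 'I_k -> N}) := masked_obj M tau h.
pose G h := [set w | ratio_at_most (F h) k (output (F h) (A k w)) r].
have mG h : measurable (G h).
  exact: (measurable_output_in A k (F h) [set S | ratio_at_most (F h) k S r]).
have [|||h PG] :=
  @exists_le_average R d T P _ (fun h => ~` G h) (1 / 2 `^ (1 / 128 * x)).
- by move=> h; exact: measurableC.
- by rewrite card_ffun expn_gt0 N1.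
- move=> w.
  apply: le_trans (card_bad_instances tau0 _ k0 N1 r0 _ r_k (A k w)) _.
  + exact: tau_le_base.
  + exact: tau_le_size.
  rewrite mulrA ler_wpM2r //; apply: union_bound_le => //; first exact: tail_exponent.
  (* Only the run on [uniform_obj] is counted; it is itself an admissible instance, so the query
     bound applies to it. *)
  by apply: qA; exact: uniform_obj_approx.
exists k, (F h); split.
  by apply: masked_obj_approx => //; exact: tau_eps.
by rewrite -/(G h) -[G h]setCK probability_setC ?EFinB ?leeB //; exact: measurableC.
Qed.
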